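(* Let $R$ be an associative unital ring, let $\kappa\geq\operatorname{card}(R)+\aleph_0$ be a cardinal, let $\mathcal{D}$ be a $\kappa^+$-deconstructible class of right $R$-modules, and let $\mathcal{M}$ be either the class of all embeddings, all RD-embeddings, or all pure embeddings. Let $A,B,C\in\mathcal{D}$ with $A\leq_{\mathcal{M}}C$ and $B\leq_{\mathcal{M}}C$. Then there are $L,T\in\mathcal{D}$ such that $\|L\|,\|T\|\leq\|A\|+\kappa$, $L\leq_{\mathcal{M}}B$, $T\leq_{\mathcal{M}}C$, $A\leq_{\mathcal{M}}T$, $T\leq_{\mathcal{M}_Q}C$, $L\leq_{\mathcal{M}_Q}B$, and $T$ is free from $B$ over $L$ in $C$.
   Context: Modules are right $R$-modules; $\|M\|$ denotes the cardinality of a module $M$. For an infinite cardinal $\mu$, a module is $<\mu$-presented if it has a presentation with fewer than $\mu$ generators and fewer than $\mu$ relations. For a class $\mathcal{C}$ of modules, a module $M$ is $\mathcal{C}$-filtered if there are an ordinal $\delta$ and an increasing chain of submodules $(M_i\mid i\leq\delta)$ of $M$ with $M_0=0$, $M_\delta=M$, $M_i=\bigcup_{j<i}M_j$ for limit $i\leq\delta$, and $M_{i+1}/M_i$ isomorphic to a member of $\mathcal{C}$ for all $i<\delta$. A class $\mathcal{D}$ is $\mu$-deconstructible if $\mathcal{D}$ is exactly the class of all $\mathcal{D}^{<\mu}$-filtered modules, where $\mathcal{D}^{<\mu}$ is the class of all $<\mu$-presented modules in $\mathcal{D}$. An embedding is a monomorphism. A submodule $N$ of $M$ is an RD-submodule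 if $N\cap Mr=Nr$ for all $r\in R$; it is a pure submodule if every finite system of $R$-linear equations with right-hand side in $N$ that is solvable in $M$ is solvable in $N$. An RD-embedding (pure embedding) is a monomorphism whose image is an RD-submodule (pure submodule) of its codomain. An $\mathcal{M}$-embedding is a member of $\mathcal{M}$. For $A,B\in\mathcal{D}$, $A\leq_{\mathcal{M}}B$ means that $A$ is a submodule of $B$ and the inclusion is in $\mathcal{M}$; $A\leq_{\mathcal{M}_Q}B$ means that moreover $B/A\in\mathcal{D}$. Independence: let $A_0,A_1,A_2,A_3\in\mathcal{D}$ and let $f_1:A_0\to A_1$, $f_2:A_0\to A_2$, $g_1:A_1\to A_3$, $g_2:A_2\to A_3$ be $\mathcal{M}$-embeddings with $g_1f_1=g_2f_2$. Let $(P,h_1,h_2)$ be the pushout of $(f_1,f_2)$ in the category of right $R$-modules ($P$ need not be in $\mathcal{D}$). The square $(f_1,f_2,g_1,g_2)$ is independent if the unique homomorphism $t:P\to A_3$ with $th_1=g_1$, $th_2=g_2$ is an $\mathcal{M}$-embedding. For $A_0,\dots,A_3\in\mathcal{D}$, ''$A_1$ is free from $A_2$ over $A_0$ in $A_3$'' means that $A_0\leq_{\mathcal{M}}A_1\leq_{\mathcal{M}}A_3$, $A_0\leq_{\mathcal{M}}A_2\leq_{\mathcal{M}}A_3$, and the square of inclusions $A_0\to A_1$, $A_0\to A_2$, $A_1\to A_3$, $A_2\to A_3$ is independent. *)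

(* Defs.v *)
(* MathComp, with the classical layer of MathComp-Analysis for sets and
   cardinalities. *)
From HB Require Import structures.
From mathcomp Require Import all_boot all_order all_algebra.
From mathcomp Require Import boolp classical_sets functions cardinality.
Set Implicit Arguments.
Unset Strict Implicit.
Unset Printing Implicit Defensive.
Import Order.TTheory GRing.Theory.
Local Open Scope ring_scope.
Local Open Scope quotient_scope.
Local Open Scope classical_set_scope.
Local Open Scope card_scope.

(* A right R-module is a left module over the converse ring: [r *: m] with
   [r : R^c] is the right action [m r]. *)
Notation rmodType R := (lmodType R^c).

Section Submodules.
Variables (S : pzRingType) (X : lmodType S).
Implicit Types A B : submodClosed X.

Definition submodule A := {x : X | x \in A}.
HB.instance Definition _ A := [isSub of submodule A for @sval _ _].
HB.instance Definition _ A := [Choice of submodule A by <:].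
HB.instance Definition _ A :=
  [SubChoice_isSubLmodule of submodule A by <:].

(* [submodClosed] does not inherit [zmodClosed] in MathComp, hence [submod_pred]. *)
Lemma submod_zmod_closed A : zmod_closed (A : {pred X}).
Proof. exact: GRing.submod_closedB (submodClosedP A). Qed.

Definition submod_pred A : {pred X} := A.
HB.instance Definition _ A :=
  GRing.isZmodClosed.Build X (submod_pred A) (submod_zmod_closed A).

Definition quotmod A := Quotient.quot (submod_pred A).
HB.instance Definition _ A := GRing.Zmodule.on (quotmod A).

Definition quotmod_scale A (a : S) (x : quotmod A) : quotmod A :=
  \pi_(Quotient.quot (submod_pred A)) (a *: repr x).

Lemma quotmod_eqP A (x y : X) :
  reflect (\pi_(Quotient.quot (submod_pred A)) x =
           \pi_(Quotient.quot (submod_pred A)) y) (x - y \in A).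
Proof.
have -> : (x - y \in A) = (x - y \in submod_pred A) by [].
by rewrite Quotient.idealrBE; exact: eqP.
Qed.

Lemma quotmod_scale_pi A a (x : X) :
  quotmod_scale a (\pi_(Quotient.quot (submod_pred A)) x : quotmod A) =
  \pi_(Quotient.quot (submod_pred A)) (a *: x).
Proof.
apply/quotmod_eqP; rewrite -scalerBr; apply: rpredZ.
by apply/quotmod_eqP; rewrite reprK.
Qed.

Lemma quotmod_ind A (P : quotmod A -> Prop) :
  (forall x, P (\pi_(Quotient.quot (submod_pred A)) x)) -> forall q, P q.
Proof. by move=> Ppi q; rewrite -[q]reprK. Qed.

Lemma quotmod_scalerA A a b (q : quotmod A) :
  quotmod_scale a (quotmod_scale b q) = quotmod_scale (a * b) q.
Proof. by elim/quotmod_ind: q => x; rewrite !quotmod_scale_pi scalerA. Qed.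

Lemma quotmod_scale1r A : left_id 1 (@quotmod_scale A).
Proof. by elim/quotmod_ind => x; rewrite quotmod_scale_pi scale1r. Qed.

Lemma quotmod_scalerDr A : right_distributive (@quotmod_scale A) +%R.
Proof.
move=> a; elim/quotmod_ind => x; elim/quotmod_ind => y.
by rewrite -raddfD !quotmod_scale_pi scalerDr raddfD.
Qed.

Lemma quotmod_scalerDl A (q : quotmod A) :
  {morph (@quotmod_scale A)^~ q : a b / a + b}.
Proof.
by elim/quotmod_ind: q => x a b; rewrite !quotmod_scale_pi scalerDl raddfD.
Qed.

HB.instance Definition _ A := GRing.Zmodule_isLmodule.Build S (quotmod A)
  (@quotmod_scalerA A) (@quotmod_scale1r A) (@quotmod_scalerDr A)
  (@quotmod_scalerDl A).

Definition inclusion A B (sAB : {subset A <= B}) (x : submodule A) :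
  submodule B := exist _ (val x) (sAB _ (valP x)).

Lemma inclusion_linear A B (sAB : {subset A <= B}) : linear (inclusion sAB).
Proof. by move=> a x y; exact: val_inj. Qed.
HB.instance Definition _ A B (sAB : {subset A <= B}) :=
  GRing.isLinear.Build S (submodule A) (submodule B) *:%R (inclusion sAB)
    (inclusion_linear sAB).

Definition relsub A B : {pred submodule B} := [pred x | val x \in A].
Arguments relsub : clear implicits.

Lemma relsub_closed A B : subsemimod_closed (relsub A B).
Proof.
split; first split.
- by rewrite inE linear0 rpred0.
- by move=> x y; rewrite !inE => xA yA; rewrite linearD rpredD.
- by move=> a x; rewrite !inE => xA; rewrite linearZ rpredZ.
Qed.
HB.instance Definition _ A B :=
  GRing.isSubSemiModClosed.Build S (submodule B) (relsub A B)
    (relsub_closed A B).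

End Submodules.
Arguments relsub {S X} A B.

(* [quotient_by B A] is the module B / A when A is contained in B. *)
Definition quotient_by (S : pzRingType) (X : lmodType S)
    (B A : submodClosed X) : lmodType S := quotmod (relsub A B).

Section Modules.
Variable R : pzRingType.
Implicit Types (D E : rmodType R -> Prop).

Definition isomorphic (M N : rmodType R) :=
  exists f : {linear M -> N}, bijective f.

(* Cardinals are represented by types. *)

Definition card_lt (T U : Type) := ~ ([set: U] #<= [set: T]).

Definition successor_cardinal (kappa mu : Type) :=
  card_lt kappa mu /\
  forall Y : set mu, ~ ([set: mu] #<= Y) -> Y #<= [set: kappa].

Definition free_on (I : Type) (F : rmodType R) (e : I -> F) :=
  forall (N : rmodType R) (u : I -> N),
    exists g : {linear F -> N}, (forall i, g (e i) = u i) /\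
      forall g' : {linear F -> N}, (forall i, g' (e i) = u i) -> g' =1 g.

(* An exact sequence F1 -> F0 -> M -> 0 with F0 and F1 free on fewer than
   mu generators; the images in F0 of the generators of F1 are the relations. *)
Definition lt_presented (mu : Type) (M : rmodType R) :=
  exists (I J : Type) (F0 F1 : rmodType R) (e0 : I -> F0) (e1 : J -> F1)
         (d : {linear F1 -> F0}) (p : {linear F0 -> M}),
    [/\ card_lt I mu /\ card_lt J mu, free_on e0, free_on e1,
        range p = setT & p @^-1` [set 0] = range d].

(* In a well-order: [j] is the successor of [i]. *)
Definition is_next (d : Order.disp_t) (I : tbOrderType d) (i j : I) :=
  (i < j)%O /\ forall k, (i < k)%O -> (j <= k)%O.

(* The ordinals i <= delta form a well-order with least element 0 and greatest
   element delta, here \bot and \top. *)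
Definition filtered E (M : rmodType R) :=
  exists (d : Order.disp_t) (I : tbOrderType d) (F : I -> submodClosed M),
    well_founded (fun i j : I => (i < j)%O) /\
    [/\ forall i j, (i <= j)%O -> {subset F i <= F j},
        forall x, (x \in F \bot%O) = (x == 0),
        forall x, x \in F \top%O,
        forall i, i != \bot%O -> (forall j, ~ is_next j i) ->
          forall x, x \in F i <-> exists2 j, (j < i)%O & x \in F j
      & forall i j, is_next i j ->
          exists2 N, E N & isomorphic (quotient_by (F j) (F i)) N].

Definition deconstructible (mu : Type) D :=
  forall M, D M <-> filtered (fun N => D N /\ lt_presented mu N) M.

Definition RD_subset (M : rmodType R) (N : set M) :=
  forall r : R^c, N `&` [set r *: m | m in [set: M]] = [set r *: n | n in N].

Definition pure_subset (M : rmodType R) (N : set M) :=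
  forall (n m : nat) (a : 'I_n -> 'I_m -> R^c) (b : 'I_n -> M),
    (forall i, N (b i)) ->
    (exists x : 'I_m -> M, forall i, \sum_j a i j *: x j = b i) ->
    exists x : 'I_m -> M,
      (forall j, N (x j)) /\ forall i, \sum_j a i j *: x j = b i.

Definition morphism_class := forall M N : rmodType R, {linear M -> N} -> Prop.
Implicit Type MM : morphism_class.

Definition embeddings : morphism_class := fun M N f => injective f.
Definition RD_embeddings : morphism_class :=
  fun M N f => injective f /\ RD_subset (range f).
Definition pure_embeddings : morphism_class :=
  fun M N f => injective f /\ pure_subset (range f).

(* The modules compared are submodules of an arbitrary ambient module X, so that
   being a submodule is inclusion. *)

Definition leM MM (X : rmodType R) (A B : submodClosed X) :=
  exists sAB : {subset A <= B}, MM (submodule A) (submodule B) (inclusion sAB).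

Definition leMQ D MM (X : rmodType R) (A B : submodClosed X) :=
  leM MM A B /\ D (quotient_by B A).

Definition is_pushout (A0 A1 A2 P : rmodType R)
    (f1 : {linear A0 -> A1}) (f2 : {linear A0 -> A2})
    (h1 : {linear A1 -> P}) (h2 : {linear A2 -> P}) :=
  (forall x, h1 (f1 x) = h2 (f2 x)) /\
  forall (N : rmodType R) (k1 : {linear A1 -> N}) (k2 : {linear A2 -> N}),
    (forall x, k1 (f1 x) = k2 (f2 x)) ->
    exists t : {linear P -> N}, (t \o h1 =1 k1 /\ t \o h2 =1 k2) /\
      forall t' : {linear P -> N}, t' \o h1 =1 k1 -> t' \o h2 =1 k2 -> t' =1 t.

Definition independent MM (A0 A1 A2 A3 : rmodType R)
    (f1 : {linear A0 -> A1}) (f2 : {linear A0 -> A2})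
    (g1 : {linear A1 -> A3}) (g2 : {linear A2 -> A3}) :=
  exists (P : rmodType R) (h1 : {linear A1 -> P}) (h2 : {linear A2 -> P}),
    is_pushout f1 f2 h1 h2 /\
    exists t : {linear P -> A3}, [/\ t \o h1 =1 g1, t \o h2 =1 g2 & MM P A3 t].

(* A1 is free from A2 over A0 in A3. *)
Definition free_from MM (X : rmodType R) (A1 A2 A0 A3 : submodClosed X) :=
  [/\ leM MM A0 A1, leM MM A1 A3, leM MM A0 A2, leM MM A2 A3
    & exists (s01 : {subset A0 <= A1}) (s02 : {subset A0 <= A2})
             (s13 : {subset A1 <= A3}) (s23 : {subset A2 <= A3}),
        independent MM (inclusion s01) (inclusion s02)
                       (inclusion s13) (inclusion s23)].

End Modules.
Arguments embeddings R : clear implicits.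
Arguments RD_embeddings R : clear implicits.
Arguments pure_embeddings R : clear implicits.

(* Main.v *)
Require Import Defs.
From HB Require Import structures.
From mathcomp Require Import all_boot all_order all_algebra.
From mathcomp Require Import boolp classical_sets functions cardinality.
Set Implicit Arguments.
Unset Strict Implicit.
Unset Printing Implicit Defensive.
Import Order.TTheory GRing.Theory.
Local Open Scope ring_scope.
Local Open Scope classical_set_scope.
Local Open Scope card_scope.

(** Let [T] be a submodule of [C] containing [A], put [L := T :&: B], and let
    [F] be a filtration of [C] witnessing that [C] is in [D].  Suppose that
    [T] is adapted to [F]: on each factor [F j / F i] of the filtration, [T]
    induces either nothing or everything.  Then the traces [T :&: F i] filter
    [T], and the images of the [F i] filter [C / T], and in both cases each
    factor is zero or a factor of [F]; so [T] and [C / T] are in [D].  This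
    replaces the combinatorics of Hill's lemma, and adaptedness is a closure
    condition: every nonzero [x] in [C] first appears in a unique successor step
    from [F i] to [F j], and it suffices that [T] contains, with [x], the at
    most [kappa] chosen elements of [F j] that generate it modulo [F i]
    ([ex_adapting], [ex_hill]).  The same holds for [L], [B] and a filtration of
    [B].

    Each of the three kinds of embedding says that solvability of some linear
    systems descends from the large module to the small one: of no system, of
    one equation in one unknown, of all finite systems ([leM_solves_in]).  So
    purity is a closure condition as well: with the right-hand sides, [T] must
    contain one chosen solution, when there is one.  This is imposed on systems
    solvable in [C], so that [T] is pure in [C]; on systems solvable in [B], so
    that [L] is pure in [B]; and on systems solvable in [C] modulo [B], so that
    [T + B] is pure in [C] ([solves_in_sum]).  The last point is independence,
    because the pushout of [T] and [B] over [T :&: B] is [T + B]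
    ([sum_is_pushout]).

    All these closure conditions are finitary, and each adds at most as many
    elements as there are in [K := A + kappa] for each finite sequence; hence
    closing [A] yields a [T] no larger than [K] ([finitary_closure]).  The count
    rests on [K * K] being no larger than [K] ([card_square]). *)

(** * Cardinal arithmetic *)

(** Relations in place of functions spare a default value when [U] might be
    empty. *)
Lemma card_le_relP T U (A : set T) (B : set U) :
  A #<= B <-> exists2 Q : T -> U -> Prop,
    forall x, A x -> exists2 y, B y & Q x y &
    forall x x' y, A x -> A x' -> Q x y -> Q x' y -> x = x'.
Proof.
split=> [/card_leP/injfunPex[f _ finj]|[Q Qtot Qinj]].
  exists (fun x y => exists Ax : x \in A, val (f (SigSub Ax)) = y) => [x|].
    by move=> /mem_set Ax; exists (val (f (SigSub Ax)));
       [apply/set_mem/(valP (f (SigSub Ax))) | exists Ax].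
  move=> x x' y _ _ [Ax <-] [Ax' /val_inj].
  by move=> /finj; rewrite !inE => /(_ I I) [].
have totA (x : A) : {y : B | Q (val x) (val y)}.
  apply: cid; have [y By Qy] := Qtot _ (set_mem (valP x)).
  by exists (SigSub (mem_set By)).
have [f injf] : exists f : A -> B, injective f.
  exists (fun x => sval (totA x)) => x x' eqf.
  apply: val_inj.
  apply: (Qinj _ _ (val (sval (totA x)))).
  - exact/set_mem/(valP x).
  - exact/set_mem/(valP x').
  - exact: svalP (totA x).
  - by rewrite eqf; exact: svalP (totA x').
apply/card_leP; apply/injfunPex; exists f => //.
by move=> x x' _ _; exact: injf.
Qed.

Lemma card_leTP T U : [set: T] #<= [set: U] <-> exists f : T -> U, injective f.
Proof.
split=> [/card_le_relP[Q Qtot Qinj]|[f injf]].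
  have /choice[f Qf] : forall x, exists y, Q x y.
    by move=> x; have [y _ Qxy] := Qtot x I; exists y.
  by exists f => x x' eqf; apply: (Qinj x x' (f x)) => //; rewrite eqf.
apply/card_le_relP; exists (fun x y => f x = y) => [x _|x x' y _ _ <-].
  by exists (f x).
by move/esym/injf.
Qed.

(** [Zorn_bigcup] also asks for the empty chain, whose union cannot be required
    to contain [G0]; hence the detour by the sets [G] such that [G0 `|` G] is
    in [P]. *)
Lemma Zorn_bigcup_above T (P : set (set T)) (G0 : set T) : P G0 ->
    (forall F : set (set T), F !=set0 -> F `<=` P -> total_on F subset ->
      P (\bigcup_(X in F) X)) ->
  exists G, [/\ P G, G0 `<=` G & forall H, G `<` H -> ~ P H].
Proof.
move=> PG0 chainP.
have [F FP totF|G [PG maxG]] := @Zorn_bigcup T [set G | P (G0 `|` G)].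
  rewrite /=; have [->|Fn0] := eqVneq F set0.
    by rewrite bigcup_set0 setU0.
  have -> : G0 `|` \bigcup_(X in F) X = \bigcup_(Y in setU G0 @` F) Y.
    have /set0P[X0 FX0] := Fn0.
    apply/seteqP; split=> x.
      case=> [G0x|[X FX Xx]]; last by exists (G0 `|` X); [exists X | right].
      by exists (G0 `|` X0); [exists X0 | left].
    by case=> _ [X FX <-] [G0x|Xx]; [left | right; exists X].
  have /set0P[X0 FX0] := Fn0.
  apply: chainP; first by exists (G0 `|` X0), X0.
    by move=> _ [X FX <-]; exact: FP.
  move=> _ _ [X FX <-] [Y FY <-].
  by have [XY|YX] := totF _ _ FX FY; [left|right]; exact: setUS.
exists (G0 `|` G); split=> // H [GH HG] PH.
have G0H : G0 `<=` H by move=> x G0x; apply: GH; left.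
apply: (maxG H); last by rewrite /= setUC setUidl.
split=> [x Gx|HsG]; first by apply: GH; right.
by apply: HG => x Hx; right; apply: HsG.
Qed.

Lemma bigcup_total_on T (F : set (set T)) p q : total_on F subset ->
  (\bigcup_(X in F) X) p -> (\bigcup_(X in F) X) q ->
  exists X, [/\ F X, X p & X q].
Proof.
move=> totF [X FX Xp] [Y FY Yq].
by have [XY|YX] := totF _ _ FX FY;
   [exists Y; split=> //; exact: XY | exists X; split=> //; exact: YX].
Qed.

(** Comparability of cardinals: a maximal partial injection between [A] and [B]
    is total on one of the two sides, since otherwise one more pair fits. *)
Lemma card_le_total T U (A : set T) (B : set U) : A #<= B \/ B #<= A.
Proof.
pose P (G : set (T * U)) :=
  [/\ forall p, G p -> A p.1 /\ B p.2,
      forall x y y', G (x, y) -> G (x, y') -> y = y'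
    & forall x x' y, G (x, y) -> G (x', y) -> x = x'].
have [F FP totF|G [[GAB Gfun Ginj] maxG]] := @Zorn_bigcup _ P.
  split=> [p [X FX Xp]|x y y' xy xy'|x x' y xy x'y].
  - by have [+ _ _] := FP X FX; apply.
  - have [X [FX Xp Xq]] := bigcup_total_on totF xy xy'.
    by have [_ + _] := FP X FX; apply; [exact: Xp | exact: Xq].
  - have [X [FX Xp Xq]] := bigcup_total_on totF xy x'y.
    by have [_ _] := FP X FX; apply; [exact: Xp | exact: Xq].
have [Atot|/existsNP[x0 /not_implyP[Ax0 nGx0]]] :=
    pselect (forall x, A x -> exists y, G (x, y)).
  left; apply/card_le_relP; exists (fun x y => G (x, y)) => [x Ax|x x' y _ _].
    by have [y Gxy] := Atot x Ax; exists y => //; have [] := GAB _ Gxy.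
  exact: Ginj.
have [Btot|/existsNP[y0 /not_implyP[By0 nGy0]]] :=
    pselect (forall y, B y -> exists x, G (x, y)).
  right; apply/card_le_relP; exists (fun y x => G (x, y)) => [y By|y y' x _ _].
    by have [x Gxy] := Btot y By; exists x => //; have [] := GAB _ Gxy.
  exact: Gfun.
case: (maxG (G `|` [set (x0, y0)])).
  split=> [p Gp|]; first by left.
  by move=> /(_ (x0, y0)) GG; apply: nGx0; exists y0; apply: GG; right.
split=> [p [/GAB //|->//]|x y y' [Gxy|[-> ->]] [Gxy'|[]]
        |x x' y [Gxy|[-> ->]] [Gxy'|[]]] //.
- exact: Gfun Gxy Gxy'.
- by move=> ex; case: nGx0; exists y; rewrite -ex.
- by case: nGx0; exists y'.
- exact: Ginj Gxy Gxy'.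
- by move=> _ ey; case: nGy0; exists x; rewrite -ey.
- by case: nGy0; exists x'.
Qed.

Definition diag_field K (G : set (K * K * K)) : set K :=
  [set x | exists z, G (x, x, z)].

(** [G (x, y, z)] reads: [z] is a code of the pair [(x, y)].  The domain of the
    coding is recovered from [G] as its [diag_field], so that Zorn's lemma can
    be applied to the graphs alone. *)
Definition square_code K (G : set (K * K * K)) :=
  [/\ forall x y z, G (x, y, z) ->
        [/\ diag_field G x, diag_field G y & diag_field G z],
      forall x y, diag_field G x -> diag_field G y -> exists z, G (x, y, z)
    & forall x y x' y' z, G (x, y, z) -> G (x', y', z) -> x = x' /\ y = y'].

Lemma square_code_nat K (u : nat -> K) : injective u ->
  square_code [set (u m.1, u m.2, u (pickle m)) | m in [set: nat * nat]].
Proof.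
move=> injS; set G := (X in square_code X).
have SG n : diag_field G (u n) by exists (u (pickle (n, n))), (n, n).
split=> [x y z [[m n] _ [<- <- <-]]|x y|].
- by split; apply: SG.
- move=> [z [[m ?] _ [<- _ _]]] [z' [[n ?] _ [<- _ _]]].
  by exists (u (pickle (m, n))), (m, n).
- move=> x y x' y' z [[m n] _ [<- <- <-]] [[m' n'] _ [<- <-]].
  by move=> /injS /(pcan_inj pickleK) [-> ->].
Qed.

Lemma square_code_bigcup K (F : set (set (K * K * K))) :
  F `<=` @square_code K -> total_on F subset ->
  square_code (\bigcup_(X in F) X).
Proof.
move=> FP totF.
split=> [x y z [X FX Xxyz]|x y [u xu] [v yv]|x y x' y' z xyz xyz'].
- have [/(_ _ _ _ Xxyz)[[u ?] [v ?] [w ?]] _ _] := FP X FX.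
  by split; [exists u, X | exists v, X | exists w, X].
- have [X [FX Xp Xq]] := bigcup_total_on totF xu yv; have [_ Xtot _] := FP X FX.
  by have [||z ?] := Xtot x y; [exists u | exists v | exists z, X].
- have [X [FX Xp Xq]] := bigcup_total_on totF xyz xyz'; have [_ _] := FP X FX.
  by apply; [exact: Xp | exact: Xq].
Qed.

(** A code on [S] is enlarged to [S] and a disjoint copy [r S]: the three new
    blocks of the square are sent into the copy, the tags [a], [b] and [c]
    keeping them apart. *)
Lemma square_code_extend K (G : set (K * K * K)) (r : K -> K) (a b c : K) :
    square_code G -> diag_field G a -> diag_field G b -> diag_field G c ->
    a <> b -> a <> c -> b <> c ->
    (forall x, diag_field G x -> ~ diag_field G (r x)) ->
    (forall x y, diag_field G x -> diag_field G y -> r x = r y -> x = y) ->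
  exists2 H, G `<` H & square_code H.
Proof.
move=> [GS Gtot Ginj] Sa Sb Sc ab ac bc rS rinj.
pose S := diag_field G.
pose tagged x y t z := exists v w, [/\ G (x, y, v), G (v, t, w) & z = r w].
pose H := G `|` [set p : K * K * K | exists x y,
  [\/ p.1 = (x, r y) /\ tagged x y a p.2, p.1 = (r x, y) /\ tagged x y b p.2
    | p.1 = (r x, r y) /\ tagged x y c p.2]].
have tagS x y t z : tagged x y t z -> [/\ S x, S y & exists2 w, S w & z = r w].
  move=> [v [w [xyv vtw ->]]]; have [Sx Sy _] := GS _ _ _ xyv.
  by split=> //; exists w => //; have [] := GS _ _ _ vtw.
have tag_tot x y t : S x -> S y -> S t -> exists z, tagged x y t z.
  move=> Sx Sy St; have [v xyv] := Gtot _ _ Sx Sy.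
  have [_ _ Sv] := GS _ _ _ xyv; have [w vtw] := Gtot _ _ Sv St.
  by exists (r w), v, w.
have tag_inj x y t x' y' t' z : tagged x y t z -> tagged x' y' t' z ->
    [/\ x = x', y = y' & t = t'].
  move=> [v [w [xyv vtw ->]]] [v' [w' [xyv' vtw' rw]]].
  have [_ _ Sw] := GS _ _ _ vtw; have [_ _ Sw'] := GS _ _ _ vtw'.
  have ww := rinj _ _ Sw Sw' rw; rewrite -{}ww in vtw'.
  have [vv tt] := Ginj _ _ _ _ _ vtw vtw'; rewrite -{}vv in xyv'.
  by have [] := Ginj _ _ _ _ _ xyv xyv'.
have GNtag x y z x' y' t : G (x, y, z) -> tagged x' y' t z -> False.
  by move=> /GS[_ _ Sz] /tagS[_ _ [w Sw ez]]; apply: (rS w); rewrite // -ez.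
have SH x : S x -> diag_field H x by move=> [z Gxz]; exists z; left.
have rSH x : S x -> diag_field H (r x).
  move=> Sx; have [z xz] := tag_tot x x c Sx Sx Sc.
  by exists z; right; exists x, x; apply: Or33.
have fieldH x : diag_field H x -> S x \/ exists2 y, S y & x = r y.
  move=> [z [/GS[]|[y [y' /= xyz]]]]; first by left.
  case: xyz => [[[-> _]]|[[_ <-]]|[[-> _]]] /tagS[Sy Sy' _]; try by left.
  by right; exists y.
exists H.
  split=> [p|HG]; first by left.
  have [z xz] := rSH a Sa.
  by apply: (rS a) => //; exists z; exact: HG xz.
split=> [x y z|x y|x y x' y' z].
- move=> [/GS[? ? ?]|[x' [y' /= xyz]]]; first by split; exact: SH.
  by case: xyz => -[[-> ->] /tagS[Sx Sy [w Sw ->]]]; split;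
     try exact: SH; exact: rSH.
- move=> /fieldH[Sx|[x' Sx ->]] /fieldH[Sy|[y' Sy ->]].
  + by have [z] := Gtot _ _ Sx Sy; exists z; left.
  + have [z xz] := tag_tot x y' a Sx Sy Sa.
    by exists z; right; exists x, y'; apply: Or31.
  + have [z xz] := tag_tot x' y b Sx Sy Sb.
    by exists z; right; exists x', y; apply: Or32.
  + have [z xz] := tag_tot x' y' c Sx Sy Sc.
    by exists z; right; exists x', y'; apply: Or33.
- move=> [Gxyz|[u [v /= xyz]]] [Gxyz'|[u' [v' /= xyz']]].
  + exact: Ginj Gxyz Gxyz'.
  + by case: xyz' => -[_ /(GNtag _ _ _ _ _ _ Gxyz)].
  + by case: xyz => -[_ /(GNtag _ _ _ _ _ _ Gxyz')].
  + case: xyz => -[[-> ->] t1]; case: xyz' => -[[-> ->] t2];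
    by have [-> -> //] := tag_inj _ _ _ _ _ _ _ t1 t2; try by move=> /esym.
Qed.

(** Hessenberg's theorem.  Let [S] carry a maximal coding of its square.  If its
    complement is no larger than [S], then the whole type embeds into two
    copies of [S], hence into [S * S] and [S].  Otherwise the complement
    contains a copy of [S] and [square_code_extend] contradicts maximality. *)
Lemma card_square K : [set: nat] #<= [set: K] -> [set: K * K] #<= [set: K].
Proof.
move=> /card_leTP[u uinj].
have [G [[GS Gtot Ginj] G0G maxG]] : exists G, [/\ square_code G,
    [set (u m.1, u m.2, u (pickle m)) | m in [set: nat * nat]] `<=` G
    & forall H, G `<` H -> ~ square_code H].
  apply: Zorn_bigcup_above; first exact: square_code_nat.
  by move=> F _; exact: square_code_bigcup.
set S := diag_field G.
have Su n : S (u n) by exists (u (pickle (n, n))); apply: G0G; exists (n, n).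
have uN m n : m != n -> u m <> u n by move=> /eqP mn /uinj.
have [/card_le_relP[Q Qtot Qinj]|/card_le_relP[Q Qtot Qinj]] :=
    card_le_total (~` S) S.
  have /choice[f f_code] (x : K) : exists y, exists z, exists t,
      [/\ S y, G (z, t, y) & S x /\ (z, t) = (x, u 0%N) \/
                           [/\ ~ S x, Q x z & t = u 1%N]].
    have [Sx|nSx] := pselect (S x).
      have [y xy] := Gtot _ _ Sx (Su 0%N); exists y, x, (u 0%N).
      by have [_ _ Sy] := GS _ _ _ xy; split=> //; left.
    have [z Sz xz] := Qtot x nSx.
    have [y zy] := Gtot _ _ Sz (Su 1%N); exists y, z, (u 1%N).
    by have [_ _ Sy] := GS _ _ _ zy; split=> //; right.
  have Sf x : S (f x) by have [z [t []]] := f_code x.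
  have finj : injective f.
    move=> x x' eqf; have [z [t [_ zt xzt]]] := f_code x.
    have [z' [t' [_ zt' xzt']]] := f_code x'; rewrite -eqf in zt'.
    have [ez et] := Ginj _ _ _ _ _ zt zt'.
    case: xzt => [[Sx [zx tu]]|[nSx xz tu]];
      case: xzt' => [[Sx' [zx' tu']]|[nSx' xz' tu']].
    - by rewrite -zx ez.
    - by case: (uN 0%N 1%N) => //; rewrite -tu et.
    - by case: (uN 0%N 1%N) => //; rewrite -tu et.
    - by apply: (Qinj x x' z) => //; rewrite ez.
  have /choice[h hG] (p : K * K) : exists z, G (f p.1, f p.2, z).
    by apply: Gtot; exact: Sf.
  apply/card_leTP; exists h => -[x y] [x' y'] eqh.
  have := hG (x, y); rewrite eqh => /Ginj/(_ (hG (x', y')))[/finj + /finj].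
  by move=> /= -> ->.
have /choice[r rP] (x : K) : exists y, S x -> ~ S y /\ Q x y.
  have [Sx|] := pselect (S x); last by exists x.
  by have [y Sy Qy] := Qtot x Sx; exists y.
have [|||||||||H GH] := @square_code_extend _ G r (u 0%N) (u 1%N) (u 2%N);
  do ?[exact: Su|exact: uN] => //.
- by move=> x Sx; have [] := rP x Sx.
- move=> x y Sx Sy rxy; apply: (Qinj x y (r x)) => //.
    by have [] := rP x Sx.
  by rewrite rxy; have [] := rP y Sy.
- by move=> /(maxG _ GH).
Qed.

Section SmallSets.
Variables (K : Type) (infK : [set: nat] #<= [set: K]).

Lemma card_le_fun T (A : set T) : A #<= [set: K] ->
  exists f : T -> K, forall x x', A x -> A x' -> f x = f x' -> x = x'.
Proof.
move: infK => /card_leTP[u _] /card_le_relP[Q Qtot Qinj].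
have /choice[f fP] (x : T) : exists y, A x -> Q x y.
  have [/Qtot[y _ Qxy]|nAx] := pselect (A x); first by exists y.
  by exists (u 0%N).
exists f => x x' Ax Ax' eqf; apply: (Qinj x x' (f x)) => //; first exact: fP.
by rewrite eqf; exact: fP.
Qed.

Lemma card_countType (T : countType) : [set: T] #<= [set: K].
Proof.
apply: card_le_trans infK; apply/card_leTP.
by exists pickle; exact: pcan_inj pickleK.
Qed.

Lemma card_seq T : [set: T] #<= [set: K] -> [set: seq T] #<= [set: K].
Proof.
move: (infK) => /card_leTP[u uinj] /card_leTP[f finj].
have /card_leTP[p pinj] := card_square infK.
pose enc := foldr (fun x k => p (f x, k)) (u 0%N).
apply/card_leTP; exists (fun s => p (u (size s), enc s)) => s t /pinj[/uinj].
elim: s t => [|x s IHs] [|y t] //= [eq_sz] /pinj[/finj-> eq_enc].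
by rewrite (IHs t).
Qed.

Lemma card_funI n T : [set: T] #<= [set: K] -> [set: 'I_n -> T] #<= [set: K].
Proof.
move=> /card_seq; apply: card_le_trans; apply/card_leTP.
exists (fun f => [seq f i | i <- enum 'I_n]) => f g /eq_in_map eq_fg.
by apply/funext => i; rewrite eq_fg ?mem_enum.
Qed.

Lemma card_bigcup I T (J : set I) (F : I -> set T) :
    J #<= [set: K] -> (forall i, J i -> F i #<= [set: K]) ->
  \bigcup_(i in J) F i #<= [set: K].
Proof.
move=> /card_le_fun[f finj] FK.
have /card_leTP[p pinj] := card_square infK.
have /choice[g ginj] (i : I) : exists g : T -> K,
    J i -> forall x x', F i x -> F i x' -> g x = g x' -> x = x'.
  have [Ji|nJi] := pselect (J i).
    by have [g ?] := card_le_fun (FK i Ji); exists g.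
  by have /card_leTP[u _] := infK; exists (fun=> u 0%N).
apply/card_le_relP.
exists (fun x k => exists i, [/\ J i, F i x & k = p (f i, g i x)]).
  by move=> x [i Ji Fix]; exists (p (f i, g i x)) => //; exists i.
move=> x x' _ _ _ [i [Ji Fx ->]] [i' [Ji' Fx' /pinj[fi gx]]].
have ei := finj i i' Ji Ji' fi; rewrite -{}ei in Fx' gx *.
exact: (ginj i).
Qed.

Lemma card_setU T (A B : set T) :
  A #<= [set: K] -> B #<= [set: K] -> A `|` B #<= [set: K].
Proof.
move=> AK BK; apply: (@card_le_trans _ _ _ (\bigcup_b if b then A else B)).
  by apply: subset_card_le => x [Ax|Bx]; [exists true | exists false].
by apply: card_bigcup => [|[] _] //; exact: card_countType.
Qed.

Lemma card_seq_in (T : eqType) (A : set T) : A #<= [set: K] ->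
  [set s : seq T | {in s, forall x, A x}] #<= [set: K].
Proof.
move=> /card_le_fun[f finj].
apply: (card_le_trans _ (card_seq (card_lexx setT))).
apply/card_le_relP; exists (fun s t => t = map f s).
  by move=> s _; exists (map f s).
move=> s s' _ + + ->; elim: s s' => [|x s IHs] [|y s'] //= As As' [efxy efss].
congr (_ :: _); last first.
  by apply: IHs => // z zs; [apply: As | apply: As']; rewrite inE zs orbT.
by apply: finj => //; [apply: As | apply: As']; rewrite inE eqxx.
Qed.

(** A finite sequence of elements of the union of an increasing sequence of sets
    lies in one of them, so countably many steps reach a closed set. *)
Lemma finitary_closure (T : eqType) (A : set T) (Phi : seq T -> set T) :
    A #<= [set: K] -> (forall s, Phi s #<= [set: K]) ->
  exists B : set T, [/\ A `<=` B, B #<= [set: K]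
    & forall s, {in s, forall x, B x} -> Phi s `<=` B].
Proof.
move=> AK PhiK.
pose next (B : set T) :=
  B `|` \bigcup_(s in [set s | {in s, forall x, B x}]) Phi s.
pose B n := iter n next A.
have BS m n : (m <= n)%N -> B m `<=` B n.
  move=> /subnK <-; elim: (n - m)%N => [|k IHk] //=.
  by move=> x /IHk; left.
have BK n : B n #<= [set: K].
  elim: n => // n IHn; apply: card_setU => //.
  by apply: card_bigcup => // ; exact: card_seq_in.
exists (\bigcup_n B n); split=> [x Ax||s Bs]; first by exists 0%N.
  by apply: card_bigcup => //; exact: card_countType.
have [n Bns] : exists n, {in s, forall x, B n x}.
  elim: s Bs => [|x s IHs] Bxs; first by exists 0%N.
  have [|n Bns] := IHs; first by move=> y ys; apply: Bxs; rewrite inE ys orbT.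
  have [m _ Bmx] := Bxs x (mem_head _ _).
  exists (maxn m n) => y; rewrite inE => /predU1P[->|/Bns].
    by apply: BS Bmx; exact: leq_maxl.
  by apply: BS; exact: leq_maxr.
by move=> x sx; exists n.+1 => //; right; exists s.
Qed.

End SmallSets.

(** * Submodules, quotients and isomorphisms *)

Section SetSubmodule.
Variables (S : pzRingType) (X : lmodType S) (P : set X).

Definition asbool_pred : {pred X} := [pred x | `[< P x >]].
Hypothesis P_closed : subsemimod_closed asbool_pred.
(** The proof is an argument so that the instance below can be inferred. *)
Definition closed_pred (_ : subsemimod_closed asbool_pred) := asbool_pred.
HB.instance Definition _ := GRing.isSubSemiModClosed.Build S X
  (closed_pred P_closed) P_closed.
Definition set_submod : submodClosed X := closed_pred P_closed.
End SetSubmodule.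

Lemma ex_submod (S : pzRingType) (X : lmodType S) (P : set X) :
    P 0 -> (forall x y, P x -> P y -> P (x + y)) ->
    (forall a x, P x -> P (a *: x)) ->
  exists A : submodClosed X, forall x, x \in A <-> P x.
Proof.
move=> P0 PD PZ.
have P_closed : subsemimod_closed (asbool_pred P).
  split; first split.
  - exact/asboolP.
  - by move=> x y /asboolP Px /asboolP Py; apply/asboolP; exact: PD.
  - by move=> a x /asboolP Px; apply/asboolP; exact: PZ.
by exists (set_submod P_closed) => x; split=> /asboolP.
Qed.

Lemma submodB (S : pzRingType) (X : lmodType S) (A : submodClosed X) x y :
  x \in A -> y \in A -> x - y \in A.
Proof. by move=> xA yA; rewrite -scaleN1r rpredD // rpredZ. Qed.

Lemma ex_linear (S : pzRingType) (U V : lmodType S) (f : U -> V) :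
  linear f -> exists g : {linear U -> V}, g =1 f.
Proof.
move=> lin_f; pose g := GRing.isLinear.Build S U V *:%R f lin_f.
by exists (HB.pack_for {linear U -> V} f g).
Qed.

Lemma ex_quotmod_proj (S : pzRingType) (X : lmodType S) (A : submodClosed X) :
  exists p : {linear X -> quotmod A},
    (forall q, exists x, p x = q) /\ forall x, p x = 0 <-> x \in A.
Proof.
have [|p pE] := @ex_linear S X (quotmod A)
  \pi_(Quotient.quot (submod_pred A))%qT.
  move=> a x y; rewrite raddfD; congr (_ + _).
  exact: esym (quotmod_scale_pi A a x).
exists p; split=> [|x].
  by elim/quotmod_ind => x; exists x.
split=> [px0|xA].
  by rewrite -[x]subr0; apply/quotmod_eqP; rewrite -!pE px0 linear0.
by rewrite -(linear0 p) !pE; apply/quotmod_eqP; rewrite subr0.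
Qed.

Lemma subr_eq0P (V : zmodType) (x y : V) : x - y = 0 <-> x = y.
Proof. by split=> [/eqP|->]; rewrite ?subrr // subr_eq0 => /eqP. Qed.

Section Isomorphisms.
Variable R : pzRingType.
Implicit Types M N Q : rmodType R.

Lemma isomorphic_refl M : isomorphic M M.
Proof. by exists idfun; exists idfun. Qed.

Lemma isomorphic_sym M N : isomorphic M N -> isomorphic N M.
Proof.
move=> [f [g fK gK]].
have [|h hE] := @ex_linear _ N M g.
  by move=> a x y; rewrite -[RHS]fK linearP !gK.
by exists h; exists f => x; rewrite hE.
Qed.

Lemma isomorphic_trans M N Q :
  isomorphic M N -> isomorphic N Q -> isomorphic M Q.
Proof.
move=> [f bij_f] [g bij_g]; exists (g \o f); exact: bij_comp.
Qed.

Lemma first_isomorphism M N (A : submodClosed M) (phi : {linear M -> N}) :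
    (forall y, exists x, phi x = y) -> (forall x, phi x = 0 <-> x \in A) ->
  isomorphic (quotmod A) N.
Proof.
move=> phi_surj phi_ker; have [p [p_surj p_ker]] := ex_quotmod_proj A.
have /choice[s sK] := p_surj; have /choice[u uK] := phi_surj.
have phi_p x y : p x = p y <-> phi x = phi y.
  split=> /subr_eq0P eq0; apply/subr_eq0P; move: eq0; rewrite -!linearB.
    by move/p_ker/phi_ker.
  by move/phi_ker/p_ker.
have [|f fE] := @ex_linear _ (quotmod A) N (phi \o s).
  move=> a x y /=; rewrite -linearP; apply/phi_p.
  by rewrite linearP !sK.
exists f; exists (p \o u) => x /=.
  by rewrite fE /= -[RHS]sK; apply/phi_p; rewrite uK.
by rewrite fE /= -[RHS]uK; apply/phi_p; rewrite sK.
Qed.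

(** The hypotheses say that [f] induces an injection and a surjection between
    the subquotients; stated this way, the lemma serves both for the inclusion
    of a submodule and for the projection to a quotient. *)
Lemma quotient_by_iso M N (f : {linear N -> M})
    (F'j F'i : submodClosed N) (Fj Fi : submodClosed M) :
    (forall x, x \in F'j -> f x \in Fj) ->
    (forall x, x \in F'j -> (f x \in Fi <-> x \in F'i)) ->
    (forall y, y \in Fj -> exists2 x, x \in F'j & y - f x \in Fi) ->
  isomorphic (quotient_by F'j F'i) (quotient_by Fj Fi).
Proof.
move=> fj fi surj; have [p [p_surj p_ker]] := ex_quotmod_proj (relsub Fi Fj).
pose g (y : submodule F'j) : submodule Fj :=
  exist _ (f (val y)) (fj _ (valP y)).
have [|h hE] := @ex_linear _ _ _ g.
  by move=> a x y; apply: val_inj; rewrite /= !linearP.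
apply: (@first_isomorphism _ _ _ (p \o h)) => [q|x].
  have [y <-] := p_surj q; have [x xj yx] := surj _ (valP y).
  exists (exist _ x xj : submodule F'j); apply/esym/subr_eq0P.
  rewrite [X in _ - X]/= -linearB.
  by apply/p_ker; rewrite inE linearB hE.
by rewrite p_ker !inE hE /=; apply: fi; exact: valP.
Qed.

Lemma quotient_by_triv M (A B : submodClosed M) :
  (forall x, x \in B -> x \in A) -> forall q : quotient_by B A, q = 0.
Proof.
move=> BA q; have [p [p_surj p_ker]] := ex_quotmod_proj (relsub A B).
by have [x <-] := p_surj q; apply/p_ker; rewrite inE; apply/BA/valP.
Qed.

(** The projection to the quotient by [W] and the zero map agree on the basis,
    hence are equal. *)
Lemma free_on_span I (F : rmodType R) (e : I -> F) (W : submodClosed F) :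
  free_on e -> (forall i, e i \in W) -> forall x, x \in W.
Proof.
move=> free_e eW x; have [p [_ p_ker]] := ex_quotmod_proj W.
have [g [_ g_uniq]] := free_e (quotmod W) (fun=> 0).
apply/p_ker; rewrite (g_uniq p) => [|i]; last exact/p_ker.
by rewrite -(g_uniq (\0 : {linear F -> quotmod W})).
Qed.

End Isomorphisms.

(** * Filtrations *)

Section Filtrations.
Variable R : pzRingType.
Implicit Types M N Q : rmodType R.

(** The chain [F] is exposed so that many submodules can be tested against the
    same filtration. *)
Definition filtration (E : rmodType R -> Prop) M d (I : tbOrderType d)
    (F : I -> submodClosed M) :=
  well_founded (fun i j : I => (i < j)%O) /\
  [/\ forall i j, (i <= j)%O -> {subset F i <= F j},
      forall x, (x \in F \bot%O) = (x == 0),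
      forall x, x \in F \top%O,
      forall i, i != \bot%O -> (forall j, ~ is_next j i) ->
        forall x, x \in F i <-> exists2 j, (j < i)%O & x \in F j
    & forall i j, is_next i j ->
        exists2 N, E N & isomorphic (quotient_by (F j) (F i)) N].

(** The image of [T :&: F j] in each factor [F j / F i] is zero or the whole
    factor. *)
Definition adapted M d (I : tbOrderType d) (F : I -> submodClosed M)
    (T : set M) :=
  forall i j, is_next i j ->
    (forall x, T x -> x \in F j -> x \in F i) \/
    (forall x, x \in F j -> exists t, [/\ T t, t \in F j & x - t \in F i]).

Variable E : rmodType R -> Prop.
Hypothesis E0 : forall Z : rmodType R, (forall z : Z, z = 0) -> E Z.

(** For [T] the image of [f], the factor of the pulled back chain is the image
    of [T :&: F j] in [F j / F i]. *)
Lemma filtered_pullback M N d (I : tbOrderType d) (F : I -> submodClosed M)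
    (f : {linear N -> M}) :
  filtration E F -> injective f -> adapted F (range f) -> filtered E N.
Proof.
move=> [wfI [Fmono Fbot Ftop Flim Fnext]] finj adF.
have /choice[F' F'P] (i : I) :
    exists A : submodClosed N, forall x, x \in A <-> f x \in F i.
  apply: ex_submod => [|x y|a x].
  - by rewrite linear0 rpred0.
  - by rewrite linearD; exact: rpredD.
  - by rewrite linearZ; exact: rpredZ.
exists d, I, F'; split=> //; split.
- by move=> i j ij x /F'P xi; apply/F'P; exact: Fmono xi.
- move=> x; apply/idP/idP => [/F'P|/eqP ->]; last exact: rpred0.
  by rewrite Fbot -(inj_eq finj) linear0.
- by move=> x; apply/F'P.
- move=> i i0 ilim x; rewrite F'P Flim //.
  by split=> -[j ji xj]; exists j => //; apply/F'P.
- move=> i j ij; have [small|full] := adF i j ij.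
    exists (quotient_by (F' j) (F' i)); last exact: isomorphic_refl.
    apply: E0; apply: quotient_by_triv => x /F'P xj.
    by apply/F'P/small => //; exists x.
  have [Q EQ isoQ] := Fnext i j ij; exists Q => //.
  apply: isomorphic_trans isoQ.
  apply: (quotient_by_iso (f := f)) => [x /F'P//|x _|y yj].
    by rewrite F'P.
  have [_ [[x _ <-] xj yx]] := full y yj.
  by exists x => //; apply/F'P.
Qed.

(** For [T] the kernel of [g], the factor of the image chain is [F j] modulo
    [F i + (T :&: F j)]: it is [F j / F i] when [T] is small on this step and
    zero when [T] is full. *)
Lemma filtered_pushforward M Q d (I : tbOrderType d) (F : I -> submodClosed M)
    (g : {linear M -> Q}) :
    filtration E F -> (forall q, exists x, g x = q) ->
    adapted F [set x | g x = 0] ->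
  filtered E Q.
Proof.
move=> [wfI [Fmono Fbot Ftop Flim Fnext]] g_surj adF.
have /choice[F' F'P] (i : I) :
    exists A : submodClosed Q,
        forall q, q \in A <-> exists2 x, x \in F i & g x = q.
  apply: ex_submod => [|_ _ [x xi <-] [y yi <-]|a _ [x xi <-]].
  - by exists 0; [exact: rpred0 | rewrite linear0].
  - by exists (x + y); [exact: rpredD | rewrite linearD].
  - by exists (a *: x); [exact: rpredZ | rewrite linearZ].
exists d, I, F'; split=> //; split.
- by move=> i j ij q /F'P[x xi <-]; apply/F'P; exists x => //; exact: Fmono xi.
- move=> q; apply/idP/idP => [/F'P[x]|/eqP ->]; last exact: rpred0.
  by rewrite Fbot => /eqP -> <-; rewrite linear0.
- by move=> q; have [x <-] := g_surj q; apply/F'P; exists x.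
- move=> i i0 ilim q; rewrite F'P; split.
    move=> [x xi <-]; have [j ji xj] := (Flim i i0 ilim x).1 xi.
    by exists j => //; apply/F'P; exists x.
  move=> [j ji /F'P[x xj <-]]; exists x => //.
  by apply: Fmono xj; exact: ltW.
- move=> i j ij; have [small|full] := adF i j ij.
    have [N EN isoN] := Fnext i j ij; exists N => //.
    apply: isomorphic_trans isoN; apply: isomorphic_sym.
    apply: (quotient_by_iso (f := g)) => [x xj|x xj|y /F'P[x xj <-]].
    + by apply/F'P; exists x.
    + rewrite F'P; split=> [[y yi gxy]|xi]; last by exists x.
      rewrite -[x](subrK y) rpredD // small //=.
        by rewrite linearB gxy subrr.
      by apply: submodB => //; apply: Fmono yi; apply: ltW; case: ij.
    + by exists x => //; rewrite subrr rpred0.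
  exists (quotient_by (F' j) (F' i)); last exact: isomorphic_refl.
  apply: E0; apply: quotient_by_triv => _ /F'P[x xj <-].
  have [t [/= gt0 tj xt]] := full x xj; apply/F'P; exists (x - t) => //.
  by rewrite linearB gt0 subr0.
Qed.

End Filtrations.

(** * Deconstructible classes *)

Section Successor.
Variables (kappa mu : Type) (succ : successor_cardinal kappa mu).

Lemma card_lt_successorP T : card_lt T mu <-> [set: T] #<= [set: kappa].
Proof.
have [lt_kappa le_kappa] := succ; split=> [lt_mu|Tkappa muT]; last first.
  exact: lt_kappa (card_le_trans muT Tkappa).
have [Tmu|/lt_mu//] := card_le_total [set: T] [set: mu].
have /card_subP[Y YT _] := Tmu.
by rewrite -(card_le_eql YT); apply: le_kappa; rewrite (card_le_eqr YT).
Qed.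

Variable R : pzRingType.
Implicit Types M N Q : rmodType R.

Lemma lt_presented_generators M : lt_presented mu M ->
  exists2 G : set M, G #<= [set: kappa] &
    forall W : submodClosed M, (forall x, G x -> x \in W) -> forall x, x \in W.
Proof.
move=> [I [J [F0 [F1 [e0 [e1 [d [p [[I_lt _] free_e0 _ p_surj _]]]]]]]]].
exists (range (p \o e0)).
  by apply: card_le_trans (card_image_le _ _) _; apply/card_lt_successorP.
move=> W GW x; have [y _ <-] : range p x by rewrite p_surj.
have [W' W'P] : exists A : submodClosed F0, forall z, z \in A <-> p z \in W.
  apply: ex_submod => [|u v|a u]; first by rewrite linear0 rpred0.
  - by rewrite linearD; exact: rpredD.
  - by rewrite linearZ; exact: rpredZ.
apply/W'P; apply: free_on_span free_e0 _ _ => i.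
by apply/W'P/GW; exists i.
Qed.

(** With [deconstructible_zero], this allows zero factors in the filtrations of
    the modules of a deconstructible class. *)
Lemma lt_presented_zero M : (forall x : M, x = 0) -> lt_presented mu M.
Proof.
move=> M0; have lt_void : card_lt void mu.
  apply/card_lt_successorP/card_leTP.
  by exists (fun v : void => match v with end) => -[].
pose e (v : void) : M := match v with end.
have free_void : free_on e.
  move=> N u; exists (\0 : {linear M -> N}).
  by split=> [[]|g _ x]; rewrite (M0 x) linear0.
exists void, void, M, M, e, e, (\0 : {linear M -> M}), idfun; split=> //.
  by apply/seteqP; split=> // x _; exists x.
by apply/seteqP; split=> x _ /=; [exists 0; rewrite // (M0 x) | exact: M0].
Qed.

(** [G x] consists of generators of [F j] modulo [F i], for the step from [F i]
    to [F j] at which [x] appears.  If [T] is closed under [G] and has an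
    element of [F j] outside [F i], then that element brings these generators
    into [T], which is therefore full on this step. *)
Lemma ex_adapting M d (I : tbOrderType d) (F : I -> submodClosed M)
    (E : rmodType R -> Prop) :
    filtration (fun N => E N /\ lt_presented mu N) F ->
  exists2 G : M -> set M, forall x, G x #<= [set: kappa] &
    forall T : submodClosed M,
      (forall x, x \in T -> forall y, G x y -> y \in T) ->
      adapted F [set x | x \in T].
Proof.
move=> [_ [Fmono _ _ _ Fnext]].
have /choice[H HP] (ij : I * I) : exists H : set M, is_next ij.1 ij.2 ->
    [/\ H #<= [set: kappa], forall y, H y -> y \in F ij.2 &
    forall T : submodClosed M, (forall y, H y -> y \in T) ->
      forall x, x \in F ij.2 ->
      exists t, [/\ t \in T, t \in F ij.2 & x - t \in F ij.1]].
  case: ij => i j /=; have [ij|] := pselect (is_next i j); last by exists set0.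
  have [N [_ /lt_presented_generators[G Gkappa Gspan]]] := Fnext i j ij.
  move=> [h [k hK kK]].
  have [p [p_surj p_ker]] := ex_quotmod_proj (relsub (F i) (F j)).
  have /choice[s sK] (n : N) : exists y, h (p y) = n.
    by have [y py] := p_surj (k n); exists y; rewrite py.
  exists [set val (s n) | n in G] => _; split.
  - exact: card_le_trans (card_image_le _ _) Gkappa.
  - by move=> _ [n _ <-]; exact: valP.
  move=> T GT x xj.
  have [W WP] : exists W : submodClosed N, forall n, n \in W <->
      exists2 y, val y \in T & h (p y) = n.
    apply: ex_submod => [|_ _ [y yT <-] [z zT <-]|a _ [y yT <-]].
    - by exists 0; rewrite ?linear0 ?rpred0.
    - by exists (y + z); rewrite ?linearD ?rpredD.
    - by exists (a *: y); rewrite ?linearZ ?rpredZ.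
  have /(WP _).1[y yT hpy] : h (p (exist _ x xj)) \in W.
    apply: Gspan => n Gn; apply/WP; exists (s n) => //; apply: GT.
    by exists n.
  exists (val y); split=> //; first exact: valP.
  have /subr_eq0P := can_inj hK hpy; rewrite -linearB.
  move/p_ker; rewrite inE => yx.
  have := submodB (rpred0 (F i)) yx.
  by rewrite sub0r [val (_ - _)]linearB opprB.
(* At most one pair [(i, j)] occurs here, so that [G x] is small. *)
pose G x := [set y | exists i j,
  [/\ is_next i j, x \in F j, x \notin F i & H (i, j) y]].
have next_uniq x i j i' j' : is_next i j -> x \in F j -> x \notin F i ->
    is_next i' j' -> x \in F j' -> x \notin F i' -> (j <= j')%O.
  move=> ij xj xi [i'j' nxt] xj' xi'; rewrite leNgt; apply/negP => j'j.
  have [ii'|i'i] := leP j' i; first by case/negP: xi; exact: Fmono xj'.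
  have [_ /(_ _ i'i)] := ij; by rewrite leNgt j'j.
have next_uniq_pair x i j i' j' : is_next i j -> x \in F j -> x \notin F i ->
    is_next i' j' -> x \in F j' -> x \notin F i' -> (i, j) = (i', j').
  move=> ij xj xi ij' xj' xi'.
  have ejj : j = j'.
    apply/eqP; rewrite eq_le (next_uniq x i j i' j') //.
    exact: (next_uniq x i' j' i j).
  rewrite -{}ejj in ij' xj' *; congr (_, _).
  have [] := ltgtP i i' => // [ii'|i'i].
    by have [_ /(_ _ ii')] := ij; rewrite leNgt; case: ij' => ->.
  by have [_ /(_ _ i'i)] := ij'; rewrite leNgt; case: ij => ->.
exists G => [x|T GT i j ij].
  have [[i [j [ij xj xi]]]|nx] :=
    pselect (exists i j, [/\ is_next i j, x \in F j & x \notin F i]).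
    have [/= Hkappa _ _] := HP (i, j) ij.
    apply: card_le_trans Hkappa.
    apply: subset_card_le => y [i' [j' [ij' xj' xi']]].
    by rewrite (next_uniq_pair x i j i' j').
  rewrite (_ : G x = set0) //; apply/seteqP; split=> // y [i [j [ij xj xi _]]].
  by apply: nx; exists i, j.
have [small|/existsNP[x /not_implyP[Tx /not_implyP[xj /negP xi]]]] :=
  pselect (forall x, x \in T -> x \in F j -> x \in F i); first by left.
right; have [_ _] := HP (i, j) ij; apply => y Hy.
by apply: GT Tx _ _; exists i, j.
Qed.

Variables (D : rmodType R -> Prop) (hD : deconstructible mu D).

Lemma deconstructible_zero M : (forall x : M, x = 0) -> D M.
Proof.
move=> M0; apply/hD.
have [A AP] : exists A : submodClosed M, forall x : M, x \in A <-> True.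
  exact: ex_submod.
have ord1_lt (i j : 'I_1) : (i < j)%O = false.
  by rewrite (ord1 i) (ord1 j) ltxx.
(* The zero module is filtered along a single index, with no successor step. *)
pose I1 : tbOrderType ord_display :=
  HB.pack_for (tbOrderType ord_display) 'I_1
  (Order.Total.class 'I_1) (Order.TBPreorder.class 'I_1).
exists ord_display, I1, (fun=> A).
split; first by move=> i; constructor => j; rewrite ord1_lt.
split=> //.
- by move=> i j _ x.
- by move=> x; rewrite (M0 x) eqxx rpred0.
- by move=> x; apply/AP.
- by move=> i; rewrite (ord1 i) (ord1 \bot%O) eqxx.
- by move=> i j []; rewrite ord1_lt.
Qed.

(** A substitute for Hill's lemma: instead of a lattice of submodules, it
    provides a small unary closure operation whose closed submodules split [B]
    into two members of [D]. *)
Lemma ex_hill (X : rmodType R) (B : submodClosed X) : D (submodule B) ->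
  exists G : X -> set X, [/\ forall x, G x #<= [set: kappa],
      forall x y, G x y -> y \in B
    & forall L : submodClosed X, {subset L <= B} ->
        (forall x, x \in L -> forall y, G x y -> y \in L) ->
        D (submodule L) /\ D (quotient_by B L)].
Proof.
move=> /hD[d [I [F Ffilt]]]; have [G Gkappa Gad] := ex_adapting Ffilt.
exists (fun x => [set val y | y in
  [set y | exists2 x' : submodule B, val x' = x & G x' y]]).
split=> [x|x _ [y _ <-]|L LB GL]; last 2 first.
- exact: valP.
- have ad : adapted F [set x | x \in relsub L B].
    apply: Gad => x; rewrite inE => xL y Gxy; rewrite inE.
    by apply: GL xL _ _; exists y => //; exists x.
  have E0 (Z : rmodType R) : (forall z : Z, z = 0) -> D Z /\ lt_presented mu Z.
    move=> Z0; split; first exact: deconstructible_zero.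
    exact: lt_presented_zero.
  split; apply/hD.
    apply: (filtered_pullback E0 (f := inclusion LB) Ffilt).
      by move=> x y [/val_inj].
    suff -> : range (inclusion LB) = [set x | x \in relsub L B] by [].
    apply/seteqP; split=> [_ [x _ <-]|x] /=; rewrite inE.
      exact: (valP x).
    by move=> xL; exists (exist _ (val x) xL) => //; exact: val_inj.
  have [p [p_surj p_ker]] := ex_quotmod_proj (relsub L B).
  apply: (filtered_pushforward E0 (g := p) Ffilt) => //.
  suff -> : [set x | p x = 0] = [set x | x \in relsub L B] by [].
  by apply/seteqP; split=> x /p_ker.
apply: card_le_trans (card_image_le _ _) _.
have [xB|nxB] := pselect (x \in B).
  apply: card_le_trans (Gkappa (exist _ x xB)); apply: subset_card_le.
  by move=> y [x' ex]; rewrite (_ : x' = exist _ x xB) //; apply: val_inj.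
rewrite (_ : mkset _ = set0) //; apply/seteqP; split=> // y [x' ex].
by case: nxB; rewrite -ex; exact: valP.
Qed.

End Successor.

(** * Purity *)

Section Purity.
Variable R : pzRingType.

Definition shapes := forall n m : nat, ('I_n -> 'I_m -> R^c) -> Prop.
Implicit Types (Sigma : shapes) (X : rmodType R).

(** A solution in [U] modulo [V]. *)
Definition solution X (U V : set X) n m (a : 'I_n -> 'I_m -> R^c)
    (b : 'I_n -> X) (x : 'I_m -> X) :=
  (forall j, U (x j)) /\ forall i, V (\sum_j a i j *: x j - b i).

Definition solves_in Sigma X (U V T : set X) :=
  forall n m (a : 'I_n -> 'I_m -> R^c) b, Sigma n m a -> (forall i, T (b i)) ->
    (exists x, solution U V a b x) ->
    exists2 x, solution U V a b x & forall j, T (x j).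

(** The set [Sigma] of coefficient matrices is empty for embeddings, consists of
    the matrices of size one for RD-embeddings, and of all matrices for pure
    embeddings. *)
Lemma leM_solves_in (MM : morphism_class R) :
    [\/ MM = embeddings R, MM = RD_embeddings R | MM = pure_embeddings R] ->
  exists Sigma, forall X (A B : submodClosed X), leM MM A B <->
    {subset A <= B} /\ solves_in Sigma [set` B] [set 0] [set` A].
Proof.
have incl_inj X (A B : submodClosed X) (AB : {subset A <= B}) :
    injective (inclusion AB) by move=> x y [/val_inj].
have range_incl X (A B : submodClosed X) (AB : {subset A <= B}) y :
    range (inclusion AB) y <-> val y \in A.
  split=> [[x _ <-]|yA]; first exact: (valP x).
  by exists (exist _ (val y) yA) => //; exact: val_inj.
case=> ->.
- exists (fun n m a => False) => X A B.
  split=> [[AB _]|[AB _]]; first by split=> // n m a b [].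
  by exists AB; exact: incl_inj.
- exists (fun n m a => n = 1%N /\ m = 1%N) => X A B.
  split=> [[AB [_ rdA]]|[AB rdA]].
    split=> // n m a b [n1 m1]; subst n m => bA [x [xB /(_ ord0)/subr_eq0P]].
    rewrite big_ord1 => axb.
    pose b' : submodule B := exist _ (b ord0) (AB _ (bA ord0)).
    pose x' : submodule B := exist _ (x ord0) (xB ord0).
    have : [set a ord0 ord0 *: y | y in range (inclusion AB)] b'.
      rewrite -rdA; split; first by apply/range_incl; exact: bA.
      by exists x' => //; apply: val_inj.
    move=> [y /range_incl yA ayb].
    exists (fun=> val y); last by [].
    split=> [_|i]; first exact: valP.
    by rewrite big_ord1 !ord1; apply/subr_eq0P; rewrite -linearZ ayb.
  exists AB; split=> [|r]; first exact: incl_inj.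
  apply/seteqP.
  split=> [y [/range_incl yA [x _ rx]]|_ [y /range_incl yA <-]]; last first.
    split; first by apply/range_incl; rewrite linearZ rpredZ.
    by exists y.
  have [||z [zB /(_ ord0)/subr_eq0P]] :=
    rdA 1%N 1%N (fun _ _ => r) (fun=> val y) (conj erefl erefl).
  + by [].
  + exists (fun=> val x); split=> [_|_]; first exact: valP.
    by rewrite big_ord1; apply/subr_eq0P; rewrite -linearZ rx.
  rewrite big_ord1 => rzy zA.
  exists (exist _ (z ord0) (zB ord0)); last exact: val_inj.
  by apply/range_incl; exact: zA.
- exists (fun n m a => True) => X A B; split=> [[AB [_ pureA]]|[AB pureA]].
    split=> // n m a b _ bA [x [xB axb]].
    pose b' i : submodule B := exist _ (b i) (AB _ (bA i)).
    pose x' j : submodule B := exist _ (x j) (xB j).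
    have [||y [yA ayb]] := pureA n m a b'.
    + by move=> i; apply/range_incl; exact: bA.
    + exists x' => i; apply: val_inj; rewrite linear_sum /=.
      by have /subr_eq0P <- := axb i; apply: eq_bigr => j _; rewrite ?linearZ.
    exists (fun j => val (y j)); last by move=> j; apply/range_incl.
    split=> [j|i]; first exact: valP.
    apply/subr_eq0P; rewrite -[b i]/(val (b' i)) -ayb linear_sum.
    by apply: eq_bigr => j _; rewrite linearZ.
  exists AB; split=> [|n m a b bA [x axb]]; first exact: incl_inj.
  have [||y [yB ayb] yA] := pureA n m a (fun i => val (b i)) I.
  + by move=> i; apply/range_incl.
  + exists (fun j => val (x j)); split=> [j|i]; first exact: valP.
    apply/subr_eq0P; rewrite -axb linear_sum.
    by apply: eq_bigr => j _; rewrite linearZ.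
  exists (fun j => exist _ (y j) (yB j)); split=> [j|i].
    by apply/range_incl; exact: yA.
  apply: val_inj; have /subr_eq0P <- := ayb i; rewrite linear_sum.
  by apply: eq_bigr => j _; rewrite linearZ.
Qed.

Lemma solves_in_trans Sigma X (A B C : set X) :
  B `<=` C -> A `<=` B ->
  solves_in Sigma B [set 0] A -> solves_in Sigma C [set 0] B ->
  solves_in Sigma C [set 0] A.
Proof.
move=> BC AB purA purB n m a b Sa Ab [x xC].
have [|x' [_ ax'] Bx'] := purB n m a b Sa (fun i => AB _ (Ab i)).
  by exists x.
have [|y [yB ay] Ay] := purA n m a b Sa Ab; first by exists x'.
by exists y => //; split=> // j; exact: BC.
Qed.

Lemma solves_in_sub Sigma X (A B C : set X) :
  A `<=` B -> B `<=` C ->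
  solves_in Sigma C [set 0] A -> solves_in Sigma B [set 0] A.
Proof.
move=> AB BC purA n m a b Sa Ab [x [xB ax]].
have [|y [_ ay] Ay] := purA n m a b Sa Ab.
  by exists x; split=> // j; exact: BC.
by exists y => //; split=> // j; exact: AB.
Qed.

(** A system with right-hand side [t + b] is first solved in [T] modulo [B],
    and the remaining error is corrected inside [B]. *)
Lemma solves_in_sum Sigma X (T B C P : submodClosed X) :
    {subset T <= C} -> {subset B <= C} ->
    (forall z, z \in P <-> exists t b, [/\ t \in T, b \in B & z = t + b]) ->
    solves_in Sigma [set` C] [set 0] [set` B] ->
    solves_in Sigma [set` C] [set` B] [set` T] ->
  solves_in Sigma [set` C] [set 0] [set` P].
Proof.
move=> TC BC PE purB solT n m a z Sa Pz [x [xC axz]].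
have /choice[t tP] (i : 'I_n) : exists t, t \in T /\ z i - t \in B.
  by have /PE[t [b [tT bB ->]]] := Pz i; exists t; rewrite addrAC subrr add0r.
have [||y [yC ayt] yT] := solT n m a t Sa.
- by move=> i; have [] := tP i.
- exists x; split=> // i; have [_ ztB] := tP i.
  by have /subr_eq0P -> := axz i.
have err i : z i - \sum_j a i j *: y j \in B.
  have [_ ztB] := tP i; have := submodB ztB (ayt i).
  by rewrite opprB addrA subrK.
have [||w [wC awz] wB] := purB n m a (fun i => z i - \sum_j a i j *: y j) Sa.
- exact: err.
- exists (fun j => x j - y j); split=> [j|i].
    by apply: submodB; [exact: xC | exact: yC].
  apply/subr_eq0P; have /subr_eq0P <- := axz i.
  by rewrite -sumrB; apply: eq_bigr => j _; rewrite scalerBr.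
exists (fun j => y j + w j).
  split=> [j|i]; first by rewrite /= rpredD //; [exact: yC | exact: wC].
  apply/subr_eq0P; rewrite -[RHS](subrK (\sum_j a i j *: y j)).
  have /subr_eq0P <- := awz i.
  by rewrite addrC -big_split /=; apply: eq_bigr => j _; rewrite scalerDr.
by move=> j; apply/PE; exists (y j), (w j); split=> //; [exact: yT | exact: wB].
Qed.

(** [Phi s] collects one chosen solution for each solvable system whose
    right-hand side is an initial segment of [s], padded with zeros; there are
    no more such systems than finite matrices over [R]. *)
Lemma ex_solutions K Sigma X (U V : set X) :
    [set: nat] #<= [set: K] -> [set: R] #<= [set: K] ->
  exists Phi : seq X -> set X, [/\ forall s, Phi s #<= [set: K],
    forall s, Phi s `<=` U
    & forall T : set X, (forall s, {in s, forall x, T x} -> Phi s `<=` T) ->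
        solves_in Sigma U V T].
Proof.
move=> infK RK.
have sol n m (a : 'I_n -> 'I_m -> R^c) b :
    {x | (exists x', solution U V a b x') -> solution U V a b x}.
  by apply: cid; have [[x ?]|nx] := pselect (exists x, solution U V a b x);
    [exists x | exists (fun=> 0)].
pose f n m a b := sval (sol n m a b).
pose Phi s := \bigcup_n \bigcup_m \bigcup_(a : 'I_n -> 'I_m -> R^c)
  [set x | exists2 j, x = f n m a (fun i => s`_i) j
   & solution U V a (fun i => s`_i) (f n m a (fun i => s`_i))].
exists Phi; split=> [s|s x [n _ [m _ [a _ [j -> []]]]]|T PhiT n m a b _ Tb exx]
  //.
- apply: card_bigcup => [||n _] //; apply: card_bigcup => [||m _] //.
  apply: card_bigcup => [||a _] //; first by do 2!apply: card_funI => //.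
  apply: (@card_le_trans _ _ _ (range (f n m a (fun i => s`_i)))).
    by apply: subset_card_le => x [j -> _]; exists j.
  by apply: card_le_trans (card_image_le _ _) _; exact: card_countType.
have [s sT sE] : exists2 s : seq X, {in s, forall x, T x} &
    forall i : 'I_n, s`_i = b i.
  exists [seq b i | i <- enum 'I_n] => [_ /mapP[i _ ->]|i]; first exact: Tb.
  by rewrite (nth_map i) ?size_enum_ord // nth_ord_enum.
have sb : (fun i : 'I_n => s`_i) = b by apply/funext.
have solf : solution U V a b (f n m a b) := svalP (sol n m a b) exx.
exists (f n m a b) => // j; apply: (PhiT s) => //.
exists n => //; exists m => //; exists a => //; exists j; rewrite sb //.
Qed.

End Purity.

(** Two maps agreeing on [T :&: B] glue to a map on [T + B]: two decompositions
    of an element differ by an element of [T :&: B]. *)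
Lemma sum_is_pushout (R : pzRingType) (X : rmodType R)
    (T B L P : submodClosed X) (LT : {subset L <= T}) (LB : {subset L <= B})
    (TP : {subset T <= P}) (BP : {subset B <= P}) :
    (forall z, z \in T -> z \in B -> z \in L) ->
    (forall z, z \in P <-> exists t b, [/\ t \in T, b \in B & z = t + b]) ->
  is_pushout (inclusion LT) (inclusion LB) (inclusion TP) (inclusion BP).
Proof.
move=> TBL PE; split=> [x|N k1 k2 k12]; first exact: val_inj.
have /choice[d dP] (z : submodule P) :
    exists d : submodule T * submodule B, val z = val d.1 + val d.2.
  have /PE[t [b [tT bB zE]]] := valP z.
  by exists (exist _ t tT, exist _ b bB).
pose t z := k1 (d z).1 + k2 (d z).2.
have tE (z : submodule P) (x : submodule T) (y : submodule B) :
    val z = val x + val y -> t z = k1 x + k2 y.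
  move=> zE; apply/subr_eq0P; rewrite /t opprD addrACA -!linearB /=.
  have dxy : val ((d z).1 - x) = val (y - (d z).2).
    rewrite !linearB /=; apply/eqP; rewrite subr_eq addrAC eq_sym subr_eq.
    by rewrite -dP zE addrC.
  have lL : val ((d z).1 - x) \in L.
    by apply: TBL; [exact: valP | rewrite dxy; exact: valP].
  pose l : submodule L := exist _ (val ((d z).1 - x)) lL.
  have -> : k1 ((d z).1 - x) = k2 (y - (d z).2).
    transitivity (k1 (inclusion LT l)); first by congr (k1 _); exact: val_inj.
    by rewrite k12; congr (k2 _); apply: val_inj; exact: dxy.
  by rewrite -linearD addrA subrK subrr linear0.
have [|t' t'E] := @ex_linear _ _ _ t.
  move=> a x y.
  rewrite (tE _ (a *: (d x).1 + (d y).1) (a *: (d x).2 + (d y).2)).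
    by rewrite !linearP scalerDr addrACA.
  by rewrite !linearP /= !dP scalerDr addrACA.
exists t'; split=> [|g gk1 gk2 z].
  split=> x /=; rewrite t'E.
    by rewrite (tE _ x 0) ?linear0 ?addr0.
  by rewrite (tE _ 0 x) ?linear0 ?add0r.
rewrite t'E /t -gk1 -gk2 /= -linearD; congr (g _); apply: val_inj.
by rewrite dP linearD.
Qed.

(** * Closing a submodule under small operations *)

Lemma ex_closed_submod (R : pzRingType) K (X : rmodType R)
    (A C : submodClosed X) (Phi : seq X -> set X) :
    [set: nat] #<= [set: K] -> [set: R] #<= [set: K] -> [set` A] #<= [set: K] ->
    {subset A <= C} ->
    (forall s, Phi s #<= [set: K]) -> (forall s, Phi s `<=` [set` C]) ->
  exists T : submodClosed X, [/\ {subset A <= T}, {subset T <= C},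
    [set` T] #<= [set: K] & forall s, {subset s <= T} -> Phi s `<=` [set` T]].
Proof.
move=> infK RK AK AC PhiK PhiC.
pose Psi s := Phi s `|` [set s`_0 + s`_1] `|` range (fun a : R^c => a *: s`_0).
have pointK (x : X) : [set x] #<= [set: K].
  rewrite -(image_set1 (fun=> x) tt).
  apply: card_le_trans (card_image_le _ _) _.
  apply: card_le_trans (card_leT _) _; exact: card_countType.
have [|B [AB BK PsiB]] := finitary_closure infK (Phi := Psi) AK.
  move=> s; apply: card_setU => //; last first.
    exact: card_le_trans (card_image_le _ _) _.
  by apply: card_setU.
have [|x y|a x|T TE] := @ex_submod _ X [set x | B x /\ x \in C].
- by split; [apply: AB; exact: rpred0 | exact: rpred0].
- move=> [Bx xC] [By yC]; split; last exact: rpredD.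
  apply: (PsiB [:: x; y]); last by left; right.
  by move=> z; rewrite !inE => /orP[] /eqP->.
- move=> [Bx xC]; split; last exact: rpredZ.
  apply: (PsiB [:: x]); last by right; exists a.
  by move=> z; rewrite inE => /eqP->.
exists T; split=> [x xA|x /TE[]||s sT x Phix] //.
- by apply/TE; split; [exact: AB | exact: AC].
- by apply: card_le_trans BK; apply: subset_card_le => x /TE[].
- apply/TE; split; last exact: PhiC Phix.
  by apply: (PsiB s); [move=> z /sT/TE[] | left; left].
Qed.

Theorem lemma3p16 (R : pzRingType) (kappa kappa_plus : Type)
    (hkappa : [set: R + nat] #<= [set: kappa])
    (hkappa_plus : successor_cardinal kappa kappa_plus)
    (D : rmodType R -> Prop) (hD : deconstructible kappa_plus D)
    (MM : morphism_class R)
    (hMM : [\/ MM = embeddings R, MM = RD_embeddings R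
             | MM = pure_embeddings R])
    (X : rmodType R) (A B C : submodClosed X)
    (DA : D (submodule A)) (DB : D (submodule B)) (DC : D (submodule C))
    (hAC : leM MM A C) (hBC : leM MM B C) :
  exists L T : submodClosed X,
    [/\ D (submodule L) /\ D (submodule T),
        [set: submodule L] #<= [set: submodule A + kappa] /\
        [set: submodule T] #<= [set: submodule A + kappa],
        leM MM L B /\ leM MM T C,
        leM MM A T
      & [/\ leMQ D MM T C, leMQ D MM L B & free_from MM T B L C]].
Proof.
have [Sigma leME] := leM_solves_in hMM.
have [AC purAC] := (leME X A C).1 hAC; have [BC purBC] := (leME X B C).1 hBC.
pose K := (submodule A + kappa)%type.
have kappaK : [set: kappa] #<= [set: K].
  by apply/card_leTP; exists inr => x y [].
have RNK : [set: R + nat] #<= [set: K] := card_le_trans hkappa kappaK.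
have RK : [set: R] #<= [set: K].
  by apply: card_le_trans RNK; apply/card_leTP; exists inl => x y [].
have infK : [set: nat] #<= [set: K].
  by apply: card_le_trans RNK; apply/card_leTP; exists inr => x y [].
have AK : [set` A] #<= [set: K].
  apply/card_le_relP.
  exists (fun x k => exists2 a : submodule A, val a = x & k = inl a).
    by move=> x xA; exists (inl (exist _ x xA)) => //; exists (exist _ x xA).
  by move=> x x' _ _ _ [a <- ->] [a' <- [->]].
have [GB [GBkappa GBB hillB]] := ex_hill hkappa_plus hD DB.
have [GC [GCkappa GCC hillC]] := ex_hill hkappa_plus hD DC.
have [S1 [S1K S1C S1P]] := @ex_solutions R K Sigma X [set` C] [set 0] infK RK.
have [S2 [S2K S2C S2P]] := @ex_solutions R K Sigma X [set` C] [set` B] infK RK.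
have [S3 [S3K S3B S3P]] := @ex_solutions R K Sigma X [set` B] [set 0] infK RK.
pose Phi s :=
  [set y | GB s`_0 y] `|` [set y | GC s`_0 y] `|` S1 s `|` S2 s `|` S3 s.
(* [GB] and [GC] are unary: they are applied to the head of the sequence. *)
have [||T [AT TC TK PhiT]] := ex_closed_submod (Phi := Phi) infK RK AK AC.
- move=> s; do ![apply: card_setU => //].
    exact: card_le_trans (GBkappa _) kappaK.
  exact: card_le_trans (GCkappa _) kappaK.
- move=> s x [[[[/GBB/BC//|/GCC//]|/S1C//]|/S2C//]|/S3B/BC//].
have [L LE] : exists L : submodClosed X,
    forall x, x \in L <-> x \in T /\ x \in B.
  apply: ex_submod => [|x y [? ?] [? ?]|a x [? ?]]; split;
    by [exact: rpred0 | exact: rpredD | exact: rpredZ].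
have [P PE] : exists P : submodClosed X, forall z, z \in P <->
    exists t b, [/\ t \in T, b \in B & z = t + b].
  apply: ex_submod =>
    [|_ _ [t [b [tT bB ->]]] [t' [b' [tT' bB' ->]]]|a _ [t [b [tT bB ->]]]].
  - by exists 0, 0; rewrite addr0 !rpred0.
  - by exists (t + t'), (b + b'); rewrite addrACA !rpredD.
  - by exists (a *: t), (a *: b); rewrite scalerDr !rpredZ.
have LT : {subset L <= T} by move=> x /LE[].
have LB : {subset L <= B} by move=> x /LE[].
have LC : {subset L <= C} by move=> x /LB/BC.
have TP : {subset T <= P}.
  by move=> x xT; apply/PE; exists x, 0; rewrite addr0 rpred0.
have BP : {subset B <= P}.
  by move=> x xB; apply/PE; exists 0, x; rewrite add0r rpred0.
have PC : {subset P <= C}.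
  by move=> x /PE[t [b [/TC tC /BC bC ->]]]; exact: rpredD.
have purTC : solves_in Sigma [set` C] [set 0] [set` T].
  by apply: S1P => s sT x Sx; apply: (PhiT s) => //; left; left; right.
have solTB : solves_in Sigma [set` C] [set` B] [set` T].
  by apply: S2P => s sT x Sx; apply: (PhiT s) => //; left; right.
have purLB : solves_in Sigma [set` B] [set 0] [set` L].
  apply: S3P => s sL x Sx; apply/LE; split; last exact: S3B Sx.
  by apply: (PhiT s); [move=> y /sL/LT | right].
have purLC := solves_in_trans BC LB purLB purBC.
have purLT := solves_in_sub LT TC purLC.
have purAT := solves_in_sub AT TC purAC.
have purPC := solves_in_sum TC BC PE purBC solTB.
have [DT DCT] : D (submodule T) /\ D (quotient_by C T).
  apply: hillC => // x xT y Gxy; apply: (PhiT [:: x]).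
    by move=> z; rewrite inE => /eqP->.
  by do 3!left; right.
have [DL DBL] : D (submodule L) /\ D (quotient_by B L).
  apply: hillB => // x /LE[xT xB] y Gxy; apply/LE; split; last exact: GBB Gxy.
  apply: (PhiT [:: x]); first by move=> z; rewrite inE => /eqP->.
  by do 4!left.
have small (M : submodClosed X) :
    {subset M <= T} -> [set: submodule M] #<= [set: K].
  move=> MT; apply: (card_le_trans _ TK); apply/card_le_relP.
  exists (fun x y => val x = y) => [x _|x x' _ _ _ <- /val_inj//].
  by exists (val x) => //; apply: MT; exact: valP.
have leLB : leM MM L B by apply/leME.
have leTC : leM MM T C by apply/leME.
have [PC' MMP] : leM MM P C by apply/leME.
exists L, T; split=> //.
- by split; apply: small.
- exact/leME.
split=> //; split=> //; first exact/leME.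
exists LT, LB, TC, BC.
exists (submodule P), (inclusion TP), (inclusion BP); split.
  by apply: sum_is_pushout => // z zT zB; apply/LE.
by exists (inclusion PC'); split=> // x; exact: val_inj.
Qed.
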